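(* Let $(X,d)$ be a compact metric space with diameter $D>0$. For each $\epsilon\in(0,D)$ let $S(\epsilon)$ be an optimal $\epsilon$-net of $X$ and let $\nu_\epsilon$ be the discrete probability measure uniformly distributed on $S(\epsilon)$. Then there exist a sequence $\epsilon_m\in(0,D)$ with $\lim_{m\to\infty}\epsilon_m=0$ and a Borel probability measure $\nu$ on $X$ such that $\nu_{\epsilon_m}\to\nu$ weakly as $m\to\infty$. In particular, on every such space $X$ there exists at least one uniform measure.
   Context: $D=\max\{d(x_1,x_2): x_1,x_2\in X\}$ is the diameter of $X$, and $B(x,r)=\{y\in X: d(x,y)\le r\}$ is the closed ball. $N(\epsilon)=N(X,d,\epsilon)$ is the minimal number of closed balls of radius $\epsilon$ with centers in $X$ which cover $X$. An optimal $\epsilon$-net is a set $S(\epsilon)=\{x_1(\epsilon),\dots,x_{N(\epsilon)}(\epsilon)\}\subset X$ of exactly $N(\epsilon)$ points such that the balls $B(x_k(\epsilon),\epsilon)$ cover $X$ (it need not be unique). The measure $\nu_\epsilon$ is defined on Borel sets $A$ by $$\nu_\epsilon(A)=\frac{\operatorname{card}\{k: x_k(\epsilon)\in A\}}{N(\epsilon)}.$$ Weak convergence $\nu_{\epsilon_m}\to\nu$ means $\int_X f\,d\nu_{\epsilon_m}\to\int_X f\,d\nu$ for every bounded continuous $f:X\to\mathbb{R}$. A Borel probability measure $\nu$ on $X$ is called a uniform measure (uniform distribution) if it is the weak limit of some sequence $\nu_{\epsilon_m}$ with $\epsilon_m\to 0+$. *)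

(* Defs.v *)
From HB Require Import structures.
From mathcomp Require Import all_boot all_order all_algebra finmap.
From mathcomp Require Import all_classical all_reals all_analysis.
From mathcomp Require Import lra.

Set Implicit Arguments.
Unset Strict Implicit.
Unset Printing Implicit Defensive.

Import Order.TTheory GRing.Theory Num.Theory.
Import numFieldNormedType.Exports.

Local Open Scope fset_scope.
Local Open Scope classical_set_scope.
Local Open Scope ring_scope.

(* The measurable types of the library are pointed. The distinguished point is
   only used to satisfy this requirement: any nonempty metric space, hence any
   one of positive diameter, can be pointed. *)
#[short(type="pMetricType")]
HB.structure Definition PointedMetric (K : numDomainType) :=
  {M of Metric K M & isPointed M}.

Definition borelType (R : numDomainType) (X : pMetricType R) :
  measurableType (@open X).-sigma := g_sigma_algebraType (@open X).

Section metric_nets.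
Context {R : realType} {X : pMetricType R}.
Implicit Types (x y : X) (r eps : R) (S : {fset X}).

(* Not [closed_ball x r], which is the closure of the open ball. *)
Definition metric_ball x r : set X := [set y | mdist x y <= r].

Definition net eps S : Prop :=
  \bigcup_(x in [set` S]) metric_ball x eps = [set: X].

(* The library's [get] returns a default value if no such number exists; see
   [covering_numberP] for compact spaces and positive radii. *)
Definition covering_number eps : nat :=
  get [set n | (exists2 S, net eps S & #|` S| = n) /\
               (forall S, net eps S -> (n <= #|` S|)%N)].

Definition optimal_net eps S : Prop :=
  net eps S /\ #|` S| = covering_number eps.

Lemma compact_net eps : compact [set: X] -> 0 < eps -> exists S, net eps S.
Proof.
rewrite compact_cover => cX eps0.
have [||S _ XS] := cX X setT (fun x => (ball x eps)°).
- by move=> x _; exact: open_interior.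
- by move=> x _; exists x => //; exact: nbhsx_ballx.
exists S; apply/seteqP; split=> // y _.
have [x xS /interior_subset] := XS y I.
by rewrite ballEmdist /= => /ltW xy; exists x.
Qed.

Lemma covering_numberP eps : compact [set: X] -> 0 < eps ->
  (exists2 S, net eps S & #|` S| = covering_number eps) /\
  (forall S, net eps S -> (covering_number eps <= #|` S|)%N).
Proof.
move=> cX eps0; have [S0 netS0] := compact_net cX eps0.
pose P n := `[< exists2 S, net eps S & #|` S| = n >].
have exP : exists n, P n by exists #|` S0|; apply/asboolP; exists S0.
have [n /asboolP Pn minn] := ex_minnP exP.
apply: (@getPex _ [set n | (exists2 S, net eps S & #|` S| = n) /\
  (forall S, net eps S -> (n <= #|` S|)%N)]).
exists n; split=> // S netS; apply: minn.
by apply/asboolP; exists S.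
Qed.

Lemma net_neq0 eps S : net eps S -> S != fset0.
Proof.
move=> netS; apply/negP => /eqP S0.
have : [set: X] point by [].
by rewrite -netS S0 => -[x].
Qed.

Definition net_measure S (A : set (borelType X)) : \bar R :=
  ((#|` [fset x in S | x \in A]|)%:R / (#|` S|)%:R)%:E.

Let net_measureE S : net_measure S =
  mscale ((#|` S|)%:R^-1)%:nng
    (msum (fun k => \d_(nth point S k : borelType X)) #|` S|).
Proof.
apply/funext => A; rewrite /net_measure /mscale /msum /=.
transitivity ((#|` S|%:R^-1)%:E * \sum_(x <- S) (\d_(x : borelType X) A : \bar R))%E.
  under eq_bigr do rewrite diracE.
  rewrite sumEFin -EFinM mulrC -natr_sum; congr (_ * _%:R)%:E.
  rewrite card_fset_sum1 -big_fset_condE big_mkcond /=.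
  by apply: eq_bigr => x _; case: (x \in A).
by rewrite (big_nth point) big_mkord.
Qed.

Let net_measure0 S : net_measure S set0 = 0%E.
Proof. by rewrite net_measureE measure0. Qed.

Let net_measure_ge0 S A : (0 <= net_measure S A)%E.
Proof. by rewrite net_measureE measure_ge0. Qed.

Let net_measure_sigma_additive S : semi_sigma_additive (net_measure S).
Proof. by rewrite net_measureE; exact: measure_semi_sigma_additive. Qed.

HB.instance Definition _ S := isMeasure.Build _ _ _ (net_measure S)
  (net_measure0 S) (@net_measure_ge0 S) (@net_measure_sigma_additive S).

Lemma net_measure_setT S : S != fset0 -> net_measure S setT = 1%E.
Proof.
move=> S0; rewrite /net_measure (_ : [fset x in S | _]%fset = S).
  by rewrite divff// pnatr_eq0 cardfs_eq0.
by apply/fsetP => x; rewrite !inE /= in_setT andbT.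
Qed.

(* A maximum on compact spaces, by [diameter_max]. *)
Definition diameter : R := sup [set mdist p.1 p.2 | p in [set: X * X]].

Lemma diameter_max : compact [set: X] ->
  (exists x y, mdist x y = diameter) /\ (forall x y, mdist x y <= diameter).
Proof.
move=> cX; pose f (p : X * X) : R := mdist p.1 p.2.
have cf : continuous f.
  move=> p; apply/cvgrPdist_lt => e e0.
  have e20 : 0 < e / 2 by rewrite divr_gt0.
  near=> q.
  have p1 : mdist p.1 q.1 < e / 2.
    suff : ball p.1 (e / 2) q.1 by rewrite ballEmdist.
    near: q; exists (ball p.1 (e / 2), setT) => [|q []//].
    by split; [exact: nbhsx_ballx|exact: filterT].
  have p2 : mdist p.2 q.2 < e / 2.
    suff : ball p.2 (e / 2) q.2 by rewrite ballEmdist.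
    near: q; exists (setT, ball p.2 (e / 2)) => [|q []//].
    by split; [exact: filterT|exact: nbhsx_ballx].
  have := metric_triangle p.1 q.1 p.2; have := metric_triangle q.1 q.2 p.2.
  have := metric_triangle q.1 p.1 q.2; have := metric_triangle p.1 p.2 q.2.
  rewrite (metric_sym q.2 p.2) (metric_sym q.1 p.1) /f ltr_norml.
  by move=> *; apply/andP; split; lra.
have [|||[a b] _ abmax] := @compact_EVT_max _ R f (setT `*` setT).
- by exists (point, point).
- exact: compact_setX.
- by apply: continuous_subspaceT; exact: cf.
have dE : diameter = f (a, b).
  apply/eqP; rewrite eq_le; apply/andP; split.
    apply: ge_sup; first by exists (f (a, b)), (a, b).
    by move=> _ [p _ <-]; apply: abmax; rewrite inE.
  apply: ub_le_sup; last by exists (a, b).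
  by exists (f (a, b)) => _ [p _ <-]; apply: abmax; rewrite inE.
split; first by exists a, b.
by move=> x y; rewrite dE; apply: (abmax (x, y)); rewrite inE.
Unshelve. all: by end_near. Qed.

Definition weak_cvg (mu : {measure set (borelType X) -> \bar R}^nat)
    (nu : {measure set (borelType X) -> \bar R}) : Prop :=
  forall f : X -> R, continuous f -> bounded_fun f ->
  (\int[mu m]_x (f x)%:E)%E @[m --> \oo] --> (\int[nu]_x (f x)%:E)%E.

(* [S] is any choice of one optimal net for each radius. *)
Definition uniform_measure (nu : probability (borelType X) R) : Prop :=
  exists (S : R -> {fset X}) (eps : R^nat),
  [/\ forall e, 0 < e -> optimal_net e (S e),
      forall m, 0 < eps m,
      eps @ \oo --> 0 &
      weak_cvg (fun m => net_measure (S (eps m))) nu].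

End metric_nets.

Arguments diameter {R} X.

(* Main.v *)
Require Import Defs.
From HB Require Import structures.
From mathcomp Require Import all_boot all_order all_algebra finmap.
From mathcomp Require Import all_classical all_reals all_analysis.
From mathcomp Require Import measurable_realfun.

Set Implicit Arguments.
Unset Strict Implicit.
Unset Printing Implicit Defensive.

Import Order.TTheory GRing.Theory Num.Theory.
Import numFieldNormedType.Exports.

Local Open Scope classical_set_scope.
Local Open Scope ring_scope.

(** Any sequence of uniform measures on nonempty finite subsets [S m] of a
compact metric space has a weakly convergent subsequence
([weak_cvg_subsequence]); the theorem is the case of optimal nets with radii
tending to 0. Instead of representing a positive functional by a measure, the
limit is built as the law of a random variable on the unit interval, in the
manner of Skorokhod.

Let [B n] enumerate a countable basis of open sets, and let [code n x] be the
natural number whose binary digits record which of the first [n] basic sets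
contain [x]. Sort the points of [S m] by [code m], and let [g m t] be the point
of rank [t * N], rounded down, where [N] is the cardinality of [S m]: under
Lebesgue measure on [[0, 1[], the law of [g m] is the uniform measure on [S m]
([unit_itv_measure_quantile]). The order refines the order by [code n] for all
[n <= m], so [k <= code n (g m t)] holds exactly when [t] is at least the
proportion of points of [S m] with a code [n] less than [k]
([quantile_code_ge]). These proportions are countably many numbers in [[0, 1]],
so along a subsequence they all converge ([diagonal_subsequence]). For [t] that
is not one of the countably many limits, each digit is eventually constant, that
is, [g m t] eventually stays in or out of each basic set; by compactness [g m t]
then converges ([membership_cvg]). The law of the almost sure limit is the weak
limit, by dominated convergence. *)

(** * Extraction of a subsequence *)

(** An ultrafilter finer than the neighborhoods of infinity makes all the
bounded sequences [u ^~ i] converge at once; [e m] is then picked in an element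
of the ultrafilter on which the first [m.+1] of them are close to their limits.
The map [e] need not increase: [m <= e m] is enough for limits along it. *)
Lemma diagonal_subsequence (R : realType) (I : countType)
    (u : nat -> I -> R) : (forall m i, 0 <= u m i <= 1) ->
  exists (e : nat -> nat) (c : I -> R),
    (forall m, (m <= e m)%N) /\ forall i, u (e m) i @[m --> \oo] --> c i.
Proof.
move=> u01.
have [U [UU ooU]] := @ultraFilterLemma _ (nbhs (\oo : set_system nat)) _.
have UF : ProperFilter U by exact: ultra_proper.
have cU i : exists c : R, u ^~ i @ U --> c.
  have uU : (u ^~ i @ U) `[0, 1]%classic.
    by apply: (@filterE _ U) => m /=; rewrite in_itv/=.
  have [c [_ cluc]] := @segment_compact R 0 1 _ (fmap_proper_filter _ UF) uU.
  exists c => V cV.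
  have [//|UCV] := in_ultra_setVsetC (u ^~ i @^-1` V) UU.
  by have [x []] := cluc (~` V) _ UCV cV.
have {}[c uc] := choice cU.
have near_c m : \forall k \near U, (m <= k)%N /\
    forall (j : 'I_m.+1) (i : I),
      choice.pickle i = j :> nat -> `|c i - u k i| < m.+1%:R^-1.
  apply: filterI; first by apply: ooU; exact: nbhs_infty_ge.
  apply: filter_forall => j.
  have [[i ij]|nij] := pselect (exists i : I, choice.pickle i = j :> nat).
    have := uc i; move=> /cvgrPdist_lt /(_ m.+1%:R^-1).
    rewrite invr_gt0 ltr0n => /(_ isT); apply: filterS => k cuk i'.
    by rewrite -ij => /(pcan_inj choice.pickleK) ->.
  by apply: filterE => k i ij; exfalso; apply: nij; exists i.
have [e eP] := choice (fun m => filter_ex (near_c m)).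
exists e, c; split=> [m|i]; first by have [] := eP m.
apply/cvgrPdist_lt => eps eps0; near=> m.
have [_ /(_ (inord (choice.pickle i)) i)] := eP m.
have im : (choice.pickle i < m.+1)%N.
  by rewrite ltnS; near: m; exact: nbhs_infty_ge.
rewrite inordK// => /(_ erefl) /lt_trans; apply.
by near: m; exact: near_infty_natSinv_lt (PosNum eps0).
Unshelve. all: by end_near. Qed.

(** * Coding points by the basic sets that contain them *)

Section membership_code.
Context {T : Type} (B : nat -> set T).

Fixpoint code n x : nat :=
  if n is n'.+1 then (code n' x).*2 + (x \in B n') else 0.

Lemma code_lt n x : (code n x < 2 ^ n)%N.
Proof.
elim: n => // n IH /=; rewrite expnS mul2n.
by case: (x \in B n); rewrite ?addn1 ?addn0 ?ltn_double// ltn_Sdouble.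
Qed.

Lemma odd_code n x : odd (code n.+1 x) = (x \in B n).
Proof. by rewrite /= oddD odd_double oddb. Qed.

Lemma half_code n x : (code n.+1 x)./2 = code n x.
Proof. by rewrite /= addnC half_bit_double. Qed.

(** Codes compare lexicographically, because the digits of [code n x] are the
leading ones of [code m x]. *)
Lemma le_code n m x y : (n <= m)%N ->
  (code m x <= code m y)%N -> (code n x <= code n y)%N.
Proof.
move=> /subnKC <-; elim: (m - n)%N => [|k IH]; first by rewrite addn0.
by rewrite addnS => /half_leq; rewrite !half_code; exact: IH.
Qed.

Definition code_sort m := sort (fun x y => (code m x <= code m y)%N).

(** A list sorted by [code m] is sorted by [code n] for each [n <= m], so in it
the points with [code n x < k] form an initial segment. *)
Lemma code_nth_ge x0 m n k s i : (n <= m)%N -> (i < size s)%N ->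
  (k <= code n (nth x0 (code_sort m s) i))%N =
  (count (fun x => (code n x < k)%N) s <= i)%N.
Proof.
move=> nm; set L := code_sort m s.
have sL : size L = size s by rewrite size_sort.
have -> : count (fun x => (code n x < k)%N) s =
    count (< k)%O [seq code n x | x <- L].
  by rewrite count_map count_sort.
have sortL : sorted <=%O [seq code n x | x <- L].
  rewrite sorted_map.
  apply: (@sub_sorted _ (fun x y => (code m x <= code m y)%N)).
    by move=> x y; exact: le_code.
  by apply: sort_sorted => x y; exact: leq_total.
rewrite -sL => iL; rewrite -(nth_map _ 0%N)//.
have [ci|ic] := leqP (count _ _) i.
  by apply: (nth_count_ge 0%N sortL); rewrite ci size_map.
by have := nth_count_lt 0%N sortL ic; rewrite ltEnat /= ltnNge => /negbTE.
Qed.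

End membership_code.

(** [code n] takes finitely many values, so it is determined by its comparison
with finitely many thresholds. *)
Lemma code_stabilizes {T : Type} (B : nat -> set T) n (x : nat -> T) :
  (forall k, exists b : bool,
    \forall m \near \oo, (k <= code B n (x m))%N = b) ->
  exists v, \forall m \near \oo, code B n (x m) = v.
Proof.
move=> /choice[b bP].
have near_b : \forall m \near \oo, forall k : 'I_(2 ^ n),
    (k <= code B n (x m))%N = b k.
  by apply: filter_forall => k; exact: bP.
have [m0 m0b] := filter_ex near_b.
exists (code B n (x m0)); apply: filterS near_b => m mb.
apply/eqP; rewrite eqn_leq; apply/andP; split.
  by have := m0b (Ordinal (code_lt B n (x m))); rewrite -mb leqnn.
by have := mb (Ordinal (code_lt B n (x m0))); rewrite -m0b leqnn.
Qed.

(** A countable basis comes with an injection into the natural numbers; the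
union of its elements mapped to [n] is one of them, or empty, hence open. *)
Lemma countable_basis (R : realType) (X : pMetricType R) :
  compact [set: X] -> exists B : nat -> set X, (forall n, open (B n)) /\
    forall x V, nbhs x V -> exists2 n, B n x & B n `<=` V.
Proof.
move=> cX; have [Bs cBs [oB nB]] := compact_second_countable cX.
have /countable_injP[f finj] := cBs.
pose B n := \bigcup_(A in [set A | Bs A /\ f A = n]) A.
have BE A : Bs A -> B (f A) = A.
  move=> BsA; apply/seteqP; split=> [x|x Ax]; last by exists A.
  move=> [A' [BsA' ff] A'x].
  by rewrite -(finj A' A) ?inE.
exists B; split=> [n|x V /nB [A [BsA Ax] AV]].
  by apply: bigcup_open => A [/oB].
by exists (f A); rewrite BE.
Qed.

(** Let [y] be a cluster point. A basic set around [y] is visited infinitely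
often, hence eventually always. *)
Lemma membership_cvg (X : topologicalType) (B : nat -> set X) (x : nat -> X) :
  compact [set: X] -> (forall n, open (B n)) ->
  (forall y V, nbhs y V -> exists2 n, B n y & B n `<=` V) ->
  (forall n, exists b : bool, \forall m \near \oo, (x m \in B n) = b) ->
  exists y : X, x @ \oo --> y.
Proof.
move=> cX oB nB xB.
have [y [_ ycl]] := cX (x @ \oo) _ filterT.
exists y => V /nB[n Bny BnV].
have [b xBb] := xB n.
have [z [/= zb Bnz]] := ycl [set z | (z \in B n) = b] (B n) xBb
  (open_nbhs_nbhs (conj (oB n) Bny)).
apply: filterS xBb => m; rewrite -zb (mem_set Bnz) => xmBn.
by apply: BnV; rewrite -in_setE.
Qed.

(** * Quantile functions of finite lists *)

Definition quantile {R : realType} {T : pointedType} (s : seq T) (t : R) : T :=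
  nth point s (Num.truncn (t * (size s)%:R)).

Section quantile_code.
Context {R : realType} {T : pointedType} (B : nat -> set T).
Implicit Types (s : seq T) (t : R).

Definition code_cdf n k s : R :=
  (count (fun x => (code B n x < k)%N) s)%:R / (size s)%:R.

Lemma quantile_code_ge m n k s t : (n <= m)%N -> (0 < size s)%N -> 0 <= t < 1 ->
  (k <= code B n (quantile (code_sort B m s) t))%N = (code_cdf n k s <= t).
Proof.
move=> nm s0 /andP[t0 t1].
rewrite /quantile size_sort code_nth_ge//; last first.
  rewrite truncn_lt_nat ?mulr_ge0// -ltr_pdivlMr ?ltr0n//.
  by rewrite divff ?pnatr_eq0 -?lt0n.
by rewrite truncn_ge_nat ?mulr_ge0// /code_cdf ler_pdivrMr// ltr0n.
Qed.

End quantile_code.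

Lemma cvg_le_stabilizes (R : realType) (u : nat -> R) (c t : R) :
  u @ \oo --> c -> t != c ->
  exists b : bool, \forall m \near \oo, (u m <= t) = b.
Proof.
move=> uc; rewrite neq_lt => /orP[tc|ct].
  exists false; apply: filterS (cvgr_gt c uc _ tc) => m.
  by rewrite leNgt => ->.
exists true; apply: filterS (cvgr_lt c uc _ ct) => m.
by move=> /ltW.
Qed.

(** * Measurability of limits in a metric space *)

Section borel_functions.
Context {R : realType} {X : pMetricType R}.

Lemma continuous_measurable_borel (f : borelType X -> \bar R) :
  continuous (f : X -> \bar R) -> measurable_fun [set: borelType X] f.
Proof.
move=> /continuousP cf; apply: (measurability _ (ErealGenOInfty.measurableE R)).
move=> _ [_ [a ->] <-]; rewrite setTI preimage_itvoy; apply: sub_sigma_algebra.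
by apply: (cf [set y | (a%:E < y)%E]); exact: open_ereal_gt_ereal.
Qed.

Lemma edist_inf_eq0 (C : set X) x : closed C -> edist_inf C x = 0%E -> C x.
Proof.
move=> cC x0; apply: cC => V /nbhs_ballP[e /= e0 eV].
have : (edist_inf C x < e%:E)%E by rewrite x0 lte_fin.
move=> /ereal_inf_lt[_ [y Cy <-]] /edist_lt_ball xy.
by exists y; split => //; exact: eV.
Qed.

(** The limit lies in a closed set if and only if its distance to this set is 0,
and this distance is a limit of measurable extended real-valued functions. *)
Lemma measurable_fun_metric_cvg d (T : measurableType d) (D : set T)
    (h : nat -> T -> X) (g : T -> X) :
  (forall m, measurable_fun D (h m : T -> borelType X)) ->
  (forall x, D x -> h ^~ x @ \oo --> g x) ->
  measurable_fun D (g : T -> borelType X).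
Proof.
move=> mh hg mD.
apply: (@measurability _ _ T (borelType X) D g (@open X)) => //.
move=> _ [U oU <-].
have mdist_g : measurable_fun D (edist_inf (~` U) \o g).
  apply: (@emeasurable_fun_cvg _ _ _ _ (fun m => edist_inf (~` U) \o h m)).
    move=> m; apply: measurableT_comp (mh m).
    by apply: continuous_measurable_borel; exact: edist_inf_continuous.
  move=> x Dx.
  apply: (@continuous_cvg _ _ _ _ _ (h ^~ x) (edist_inf (~` U)) (g x)).
    exact: edist_inf_continuous.
  exact: hg.
rewrite (_ : _ `&` _ = D `&` [set x | (edist_inf (~` U) \o g) x != 0%E]).
  exact: emeasurable_neq.
apply/seteqP; split=> x [Dx] /=.
  move=> Ux; split => //; apply/eqP => /edist_inf_eq0; apply => //.
  exact: open_closedC.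
move=> gx; split => //; apply: contrapT => nUgx.
by move: gx; rewrite (@edist_inf0 _ _ (~` U)) ?eqxx.
Qed.

End borel_functions.

(** * Lebesgue measure on the unit interval and laws of quantiles *)

Section unit_interval.
Context {R : realType}.

Definition unit_itv_measure : set (measurableTypeR R) -> \bar R :=
  mrestr (@lebesgue_measure R) (measurable_itv `[0, 1[).

HB.instance Definition _ := Measure.on unit_itv_measure.

Let unit_itv_measure_setT : unit_itv_measure [set: _] = 1%E.
Proof.
rewrite /unit_itv_measure /mrestr setTI lebesgue_measure_itv/=.
by rewrite lte01 oppr0 adde0.
Qed.

HB.instance Definition _ := Measure_isProbability.Build _ _ _
  unit_itv_measure unit_itv_measure_setT.

End unit_interval.

Section quantile_law.
Context {R : realType} {X : pMetricType R}.

(** The rank is a nondecreasing function of [t], so the set of the [t] with a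
given rank is an interval. *)
Lemma measurable_quantile (s : seq X) :
  measurable_fun [set: measurableTypeR R]
    (quantile s : measurableTypeR R -> borelType X).
Proof.
move=> _ A _; rewrite setTI.
rewrite (_ : _ @^-1` _ = \bigcup_(k in [set k | A (nth point s k)])
    [set t : R | Num.truncn (t * (size s)%:R) = k]).
  apply: bigcup_measurable => k _; apply: is_interval_measurable.
  move=> x y /= xk yk z /andP[xz zy]; apply/eqP; rewrite eqn_leq.
  rewrite -{1}yk -xk !le_truncn//; exact: ler_wpM2r.
apply/seteqP; split => [t At|t [k Ak] /= tk]; last by rewrite /quantile tk.
by exists (Num.truncn (t * (size s)%:R)).
Qed.

Lemma unit_itv_measure_quantile (S : {fset X}) (s : seq X)
    (A : set (borelType X)) : perm_eq s S -> S != fset0 -> measurable A ->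
  unit_itv_measure (quantile s @^-1` A) = net_measure S A.
Proof.
move=> sS S0 mA; have sizeS : size s = #|` S| := perm_size sS.
have N0 : (0 < size s)%N by rewrite sizeS lt0n cardfs_eq0.
have N0R : (0 : R) < (size s)%:R by rewrite ltr0n.
set N := size s in N0 N0R.
(* On I k the quantile function takes the value of the k-th point of s. *)
pose I k : set R := `[k%:R / N%:R, k.+1%:R / N%:R[%classic.
have IE k t : 0 <= t -> I k t <-> Num.truncn (t * N%:R) = k.
  move=> t0; rewrite /I/= in_itv/= ler_pdivrMr// ltr_pdivlMr//.
  by rewrite -truncn_eq ?mulr_ge0//; split => /eqP.
have I_ge0 k t : I k t -> 0 <= t.
  by rewrite /I/= in_itv/= => /andP[+ _]; apply: le_trans; rewrite divr_ge0.
pose F k := if nth point s k \in A then I k else set0.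
have mF k : measurable (F k).
  by rewrite /F; case: ifP => _; [exact: measurable_itv|exact: measurable0].
have lebI k : lebesgue_measure (I k) = (N%:R^-1)%:E.
  rewrite lebesgue_measure_itv/= lte_fin ltr_pM2r ?invr_gt0// ltr_nat ltnSn.
  by rewrite -EFinD -mulrBl -natrB// subSnn mul1r.
have -> : unit_itv_measure (quantile s @^-1` A) =
    lebesgue_measure (\big[setU/set0]_(k < N) F k).
  rewrite /unit_itv_measure /mrestr/= /mrestr; congr (lebesgue_measure _).
  rewrite -bigcup_mkord; apply/seteqP; split=> [t [At]|t].
    rewrite /= in_itv/= => /andP[t0 t1].
    have tN : (Num.truncn (t * N%:R) < N)%N.
      by rewrite truncn_lt_nat ?mulr_ge0// -ltr_pdivlMr// divff// gt_eqF.
    exists (Num.truncn (t * N%:R)) => //.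
    by rewrite /F mem_set//; exact/IE.
  move=> [k kN]; rewrite /F; case: ifPn => // /set_mem Ak Ikt.
  have t0 := I_ge0 _ _ Ikt.
  have tk := (IE _ _ t0).1 Ikt; split; first by rewrite /= /quantile tk.
  rewrite /= in_itv/= t0/=; move: Ikt.
  rewrite /I/= in_itv/= => /andP[_] /lt_le_trans; apply.
  by rewrite ler_pdivrMr// mul1r ler_nat.
rewrite measure_semi_additive//; last 2 first.
- apply/trivIsetP => i j _ _ ij; rewrite -subset0 => t [].
  rewrite /F; case: ifPn => // _; case: ifPn => // _ Ijt Iit.
  have t0 := I_ge0 _ _ Iit.
  move/eqP : ij; apply.
  by rewrite -((IE _ _ t0).1 Iit) -((IE _ _ t0).1 Ijt).
- by apply: bigsetU_measurable => k _; exact: mF.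
rewrite /net_measure.
transitivity (\sum_(k < N) ((nth point s k \in A)%:R / N%:R)%:E : \bar R)%E.
  apply: eq_bigr => k _; rewrite /F; case: ifPn => _.
    by rewrite mul1r; exact: lebI.
  by rewrite measure0 mul0r.
rewrite sumEFin -mulr_suml -natr_sum -sizeS; congr (_%:R / _)%:E.
rewrite card_fset_sum1 -big_fset_condE -(perm_big _ sS) (big_nth point).
by rewrite big_mkord [RHS]big_mkcond; apply: eq_bigr => k _; case: (_ \in A).
Qed.

End quantile_law.

(** * Weak compactness of uniform measures on finite sets *)

Lemma weak_cvg_subsequence (R : realType) (X : pMetricType R)
    (S : nat -> {fset X}) :
  compact [set: X] -> (forall m, S m != fset0) ->
  exists (e : nat -> nat) (nu : probability (borelType X) R),
    (forall m, (m <= e m)%N) /\ weak_cvg (fun m => net_measure (S (e m))) nu.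
Proof.
move=> cX S0.
have [B [oB nB]] := countable_basis cX.
pose L m : seq X := code_sort B m (S m).
have L0 m : (0 < size (S m))%N by rewrite lt0n cardfs_eq0.
have LS m : perm_eq (L m) (S m) by rewrite /L /code_sort perm_sort.
have [m [n k]|e [c [me ec]]] := @diagonal_subsequence R (nat * nat)%type
    (fun m nk => code_cdf B nk.1 nk.2 (S m)).
  rewrite /code_cdf divr_ge0//= ler_pdivrMr ?ltr0n// mul1r ler_nat.
  exact: count_size.
(* For t in D, each comparison code_cdf B n k (S (e m)) <= t is eventually
   constant in m. *)
pose D : set (measurableTypeR R) := `[0, 1[ `\` range c.
have countable_range_c : countable (range c).
  exact: card_le_trans (card_image_le _ _) (countableP _).
have mrc : measurable (range c).
  by apply: countable_measurable => //; exact: countable_range_c.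
have mD : measurable D by exact: measurableD.
have Dcvg t : exists y : X, D t -> quantile (L (e m)) t @[m --> \oo] --> y.
  have [[t01 ct]|nDt] := pselect (D t); last by exists point.
  have [|y ty] := membership_cvg (x := fun m => quantile (L (e m)) t) cX oB nB.
    (* Membership in B n is the last binary digit of code B n.+1. *)
    move=> n; have [|v vP] := @code_stabilizes _ B n.+1
        (fun m => quantile (L (e m)) t).
      move=> k; have tc : t != c (n.+1, k).
        by apply/eqP => tc; apply: ct; exists (n.+1, k).
      have [b bP] := cvg_le_stabilizes (ec (n.+1, k)) tc.
      exists b; near=> m; rewrite quantile_code_ge//.
      - near: m; exact: bP.
      - by rewrite (leq_trans _ (me m))//; near: m; exact: nbhs_infty_ge.
    exists (odd v); apply: filterS vP => m <-.
    by rewrite odd_code.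
  by exists y.
have [g gP] := choice Dcvg.
have mg : measurable_fun [set: measurableTypeR R]
    (g \_ D : measurableTypeR R -> borelType X).
  apply: (measurable_restrictT (g : measurableTypeR R -> borelType X) mD).1.
  apply: (measurable_fun_metric_cvg (h := fun m => quantile (L (e m)))) => //.
  by move=> m; apply: measurable_funTS; exact: measurable_quantile.
pose gm : {mfun measurableTypeR R >-> borelType X} :=
  MeasurableFun.Pack (MeasurableFun.Class (isMeasurableFun.Build _ _ _ _ _ mg)).
pose P : probability (measurableTypeR R) R := unit_itv_measure.
exists e, (distribution P gm); split => // f cf bf.
have mf : measurable_fun [set: borelType X] (EFin \o f).
  apply: continuous_measurable_borel => x.
  by apply: cvg_EFin; [exact: nearW|exact: cf].
have [M [Mreal Mf]] := bf.
have fM x : `|f x| <= M + 1 by apply: Mf => //; rewrite ltrDl.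
have fint (h : measurableTypeR R -> borelType X) : measurable_fun setT h ->
    P.-integrable setT (EFin \o f \o h).
  move=> mh; apply: (le_integrable (measurableT) (measurableT_comp mf mh) _
    (finite_measure_integrable_cst P (M + 1) measurableT)).
  move=> t _; rewrite /= lee_fin (le_trans (fM _))// ler_norm//.
have -> : (\int[distribution P gm]_x (f x)%:E)%E = (\int[P]_t (f (gm t))%:E)%E.
  by rewrite (integral_distribution (X := gm) mf)//; exact: fint.
under eq_fun => m.
  have mq := measurable_quantile (L (e m)).
  rewrite (@eq_measure_integral _ _ _ _ (pushforward P
    (quantile (L (e m)) : measurableTypeR R -> borelType X))); last first.
    move=> A mA _; apply/esym; exact: unit_itv_measure_quantile.
  rewrite (integral_pushforward mq mf (fint _ mq))//.
  over.
have [|||||_ _ //] := @dominated_convergence _ _ R P setT measurableT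
  (fun m => EFin \o f \o quantile (L (e m))) (EFin \o f \o gm) (cst (M + 1)%:E).
- by move=> m; exact: (measurableT_comp mf (measurable_quantile _)).
- exact: (measurableT_comp mf mg).
- (* The complement of D meets the unit interval in a countable set. *)
  exists (~` D); split; first exact: measurableC.
    apply/eqP; rewrite eq_le measure_ge0 andbT.
    rewrite -(countable_lebesgue_measure0 countable_range_c).
    apply: le_measure; rewrite ?inE//.
      by apply: measurableI => //; exact: measurableC.
    by move=> t [nDt t01]; apply: contrapT => nct; exact: nDt.
  move=> t /=; apply: contra_not => Dt _.
  rewrite /= patchE mem_set//.
  by apply: cvg_EFin; [exact: nearW|exact: (continuous_cvg _ (cf _) (gP t Dt))].
- exact: finite_measure_integrable_cst.
- by apply: aeW => t m _; rewrite /= lee_fin.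
Unshelve. all: by end_near. Qed.

(** * Optimal nets *)

Lemma optimal_nets_weak_cvg (R : realType) (X : pMetricType R)
    (S : R -> {fset X}) :
  compact [set: X] -> 0 < diameter X ->
  (forall e, 0 < e < diameter X -> optimal_net e (S e)) ->
  exists (eps : R^nat) (nu : probability (borelType X) R),
    [/\ forall m, 0 < eps m < diameter X,
        eps @ \oo --> 0 &
        weak_cvg (fun m => net_measure (S (eps m))) nu].
Proof.
set D := diameter X => cX D0 optS.
pose eps m : R := D / m.+2%:R.
have epsD m : 0 < eps m < D.
  by rewrite divr_gt0//= ltr_pdivrMr// ltr_pMr// ltr1n.
have [m|e [nu [me nuP]]] := @weak_cvg_subsequence _ _ (S \o eps) cX.
  by have [/net_neq0] := optS _ (epsD m).
exists (eps \o e), nu; split => // [m|]; first exact: epsD.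
have harmD : D * (@harmonic R m) @[m --> \oo] --> 0.
  by rewrite -(mulr0 D); apply: cvgMr; exact: cvg_harmonic.
apply: (squeeze_cvgr _ (cvg_cst 0) harmD); apply: nearW => m.
have /andP[/ltW -> _]/= := epsD (e m).
by rewrite ler_pM2l// lef_pV2 ?posrE// ler_nat ltnS (leq_trans (me m)) ?leqnSn.
Qed.

Theorem mainTheorem1 (R : realType) (X : pMetricType R)
    (cX : compact [set: X]) (D_gt0 : 0 < diameter X) :
  (forall S : R -> {fset X},
     (forall e, 0 < e < diameter X -> optimal_net e (S e)) ->
     exists (eps : R^nat) (nu : probability (borelType X) R),
       [/\ forall m, 0 < eps m < diameter X,
           eps @ \oo --> 0 &
           weak_cvg (fun m => net_measure (S (eps m))) nu]) /\
  (exists nu : probability (borelType X) R, uniform_measure nu).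
Proof.
split=> [S|]; first exact: optimal_nets_weak_cvg.
have optimal e : exists S : {fset X}, 0 < e -> optimal_net e S.
  have [e0|] := ltP 0 e; last by exists fset0.
  by have [[S netS cardS] _] := covering_numberP cX e0; exists S.
have [S optS] := choice optimal.
have [e /andP[e0 _]|eps [nu [epsD eps0 nuP]]] :=
  optimal_nets_weak_cvg (S := S) cX D_gt0.
  exact: optS.
exists nu, S, eps; split => // m.
by have /andP[] := epsD m.
Qed.
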